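(* Let $L,M$ be locales and let $f\colon L\to M$ be a map preserving arbitrary meets. Then $f$ is open if and only if $\mathrm{int}(f_{-1}[T])\subseteq f_{-1}[\mathrm{int}\,T]$ for every $T\subseteq M$ that is closed under arbitrary meets.
   Context: A locale (= frame) is a complete lattice $L$ with $(\bigvee A)\wedge b=\bigvee\{a\wedge b\mid a\in A\}$ for all $A\subseteq L$, $b\in L$; it has a Heyting operation $\to$ with $a\wedge b\le c\iff a\le b\to c$. A sublocale of $L$ is a subset $S\subseteq L$ closed under arbitrary meets (including the empty meet $1$) such that $x\to s\in S$ for all $x\in L$, $s\in S$. For $a\in L$, $\mathfrak o(a)=\{x\in L\mid a\to x=x\}$ is the open sublocale associated with $a$. For any subset $S\subseteq L$, $\mathrm{int}\,S=\mathfrak o(\bigvee\{a\in L\mid \mathfrak o(a)\subseteq S\})$. ''Closed under arbitrary meets'' includes the empty meet. If $f\colon L\to M$ preserves arbitrary meets and $T\subseteq M$ is closed under arbitrary meets, then $f^{-1}[T]$ is closed under arbitrary meets and $f_{-1}[T]$ denotes the largest sublocale of $L$ contained in $f^{-1}[T]$ (which exists). A map $f\colon L\to M$ between locales is open if for every $a\in L$ the image $f[\mathfrak o(a)]$ is an open sublocale of $M$. *)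

(* Defs.v *)
From HB Require Import structures.
From mathcomp Require Import all_boot all_order.
From mathcomp Require Import boolp classical_sets.
Set Implicit Arguments.
Unset Strict Implicit.
Unset Printing Implicit Defensive.
Import Order.TTheory.
Local Open Scope classical_set_scope.
Local Open Scope order_scope.

HB.mixin Record isCompleteLattice d T of Order.TBLattice d T := {
  bigsup : set T -> T;
  bigsup_ub : forall A : set T, ubound A (bigsup A);
  bigsup_le_ub : forall (A : set T) (b : T), ubound A b -> bigsup A <= b
}.

#[short(type="completeLatticeType")]
HB.structure Definition CompleteLattice d :=
  { T of Order.TBLattice d T & isCompleteLattice d T }.

HB.mixin Record isLocale d T of CompleteLattice d T := {
  bigsup_meet_distr : forall (A : set T) (b : T),
    bigsup A `&` b = bigsup [set a `&` b | a in A]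
}.

#[short(type="localeType")]
HB.structure Definition Locale d :=
  { T of CompleteLattice d T & isLocale d T }.

Section CompleteLatticeDefs.
Context {d : Order.disp_t} {L : completeLatticeType d}.

Definition bigmeet (A : set L) : L := bigsup (lbound A).

Lemma bigmeet_lb (A : set L) : lbound A (bigmeet A).
Proof. by move=> x Ax; apply: bigsup_le_ub => y; apply. Qed.

Lemma bigmeet_ge_lb (A : set L) (b : L) : lbound A b -> b <= bigmeet A.
Proof. exact: bigsup_ub. Qed.

(* [A] may be empty, so a meet-closed set contains [bigmeet set0 = \top]. *)
Definition meet_closed (S : set L) : Prop :=
  forall A : set L, A `<=` S -> S (bigmeet A).

End CompleteLatticeDefs.

Definition preserves_meets {dL dM : Order.disp_t} {L : completeLatticeType dL}
    {M : completeLatticeType dM} (f : L -> M) : Prop :=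
  forall A : set L, f (bigmeet A) = bigmeet (f @` A).

Section LocaleDefs.
Context {d : Order.disp_t} {L : localeType d}.
Implicit Types (a b c x : L) (A S X : set L).

Definition heyting a b : L := bigsup [set c | c `&` a <= b].

Lemma heytingP a b c : (a `&` b <= c) = (a <= heyting b c).
Proof.
apply/idP/idP => [|h]; first exact: bigsup_ub.
apply: (le_trans (leI2 h (lexx b))); rewrite bigsup_meet_distr.
by apply: bigsup_le_ub => _ [x xbc <-].
Qed.

Definition sublocale S : Prop :=
  meet_closed S /\ forall x s, S s -> S (heyting x s).

Definition open_sublocale a : set L := [set x | heyting a x = x].

Definition is_open_sublocale S : Prop := exists a, S = open_sublocale a.

Definition sl_interior S : set L :=
  open_sublocale (bigsup [set a | open_sublocale a `<=` S]).

Definition is_largest_sublocale_in X S : Prop :=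
  [/\ sublocale S, S `<=` X &
      forall S', sublocale S' -> S' `<=` X -> S' `<=` S].

(* The default [set0] is never reached when [X] is meet-closed: see
   [largest_sublocaleP]. *)
Definition largest_sublocale X : set L :=
  xget set0 [set S | is_largest_sublocale_in X S].

Lemma largest_sublocaleP X :
  meet_closed X -> is_largest_sublocale_in X (largest_sublocale X).
Proof.
move=> Xcl; rewrite /largest_sublocale.
pose U := [set x | exists2 S, sublocale S /\ S `<=` X & S x].
pose J := [set bigmeet A | A in [set A | A `<=` U]].
have UJ x : U x -> J x.
  move=> Ux; exists [set x]; first by move=> _ ->.
  apply/le_anti/andP; split; first exact: bigmeet_lb.
  by apply: bigmeet_ge_lb => _ ->.
suff HJ : is_largest_sublocale_in X J.
  by case: xgetP => [S _ //|/(_ J)/(_ HJ)].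
split; first split.
- move=> B BJ.
  exists [set x | U x /\ bigmeet B <= x]; first by move=> x [].
  apply/le_anti/andP; split; last by apply: bigmeet_ge_lb => x [].
  apply: bigmeet_ge_lb => y By; have [A AU Ay] := BJ _ By.
  rewrite -Ay; apply: bigmeet_ge_lb => x Ax; apply: bigmeet_lb.
  split; first exact: AU.
  by apply: (le_trans (bigmeet_lb By)); rewrite -Ay; apply: bigmeet_lb.
- move=> x _ [A AU <-].
  exists [set heyting x a | a in A].
    move=> _ [a Aa <-]; have [S [[Scl Sh] SX] Sa] := AU _ Aa.
    by exists S => //; apply: Sh.
  apply/le_anti/andP; split.
    rewrite -heytingP; apply: bigmeet_ge_lb => a Aa.
    by rewrite heytingP; apply: bigmeet_lb; exists a.
  apply: bigmeet_ge_lb => _ [a Aa <-]; rewrite -heytingP.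
  have : heyting x (bigmeet A) `&` x <= bigmeet A by rewrite heytingP.
  by move=> /le_trans; apply; apply: bigmeet_lb.
- move=> _ [A AU <-]; apply: Xcl => x Ax.
  by have [S [_ SX] Sx] := AU _ Ax; apply: SX.
- by move=> S Ssub SX x Sx; apply: UJ; exists S.
Qed.

End LocaleDefs.

Section LocaleMaps.
Context {dL dM : Order.disp_t} {L : localeType dL} {M : localeType dM}.
Variable f : L -> M.

Definition open_map : Prop :=
  forall a : L, is_open_sublocale (f @` open_sublocale a).

Definition sl_preimage (T : set M) : set L := largest_sublocale (f @^-1` T).

Lemma meet_closed_preimage (T : set M) :
  preserves_meets f -> meet_closed T -> meet_closed (f @^-1` T).
Proof.
move=> fmeet Tcl A AT; rewrite /preimage /= fmeet.
by apply: Tcl => _ [a Aa <-]; apply: AT.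
Qed.

End LocaleMaps.

(* Main.v *)
(** Writing [o a] for [open_sublocale a], an element [x] of [o (\/ b_i)] is the
    meet of the [b_i -> x], and [b_i -> x] lies in [o b_i].  Hence the interior
    of a set [S] closed under meets is contained in [S], even when [S] is not a
    sublocale.  For the converse implication this applies to [T := f @` o a]:
    the inclusion gives [o a `<=` f @^-1` int T], so [T] equals its interior. *)
Require Import Defs.
From mathcomp Require Import all_boot all_order.
From mathcomp Require Import boolp classical_sets.
Import Order.TTheory Defs.
Local Open Scope classical_set_scope.
Local Open Scope order_scope.

Section OpenSublocales.
Context {d : Order.disp_t} {L : localeType d}.
Implicit Types (a b x y : L) (A S : set L).

Lemma heyting_meet_le a x : heyting a x `&` a <= x.
Proof. by rewrite heytingP. Qed.

Lemma le_heyting a x : x <= heyting a x.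
Proof. by rewrite -heytingP; apply: leIl. Qed.

Lemma open_sublocaleP a x : open_sublocale a x <-> heyting a x <= x.
Proof.
split=> [/= -> //|h].
by apply/le_anti; rewrite h le_heyting.
Qed.

(** The operator [heyting a] is idempotent, because the meet of [a] with itself is [a]. *)
Lemma open_sublocale_heyting a x : open_sublocale a (heyting a x).
Proof.
apply/open_sublocaleP; rewrite -heytingP.
apply: le_trans (heyting_meet_le a x).
by rewrite lexI leIr heyting_meet_le.
Qed.

Lemma open_sublocale_sublocale a : sublocale (open_sublocale a).
Proof.
split=> [A AS|x s os]; apply/open_sublocaleP.
  apply: bigmeet_ge_lb => s As; rewrite -(AS _ As) -heytingP.
  exact: le_trans (heyting_meet_le _ _) (bigmeet_lb As).
(* As [s] equals [heyting a s], both [x] and [a] move to the left, where they can be swapped. *)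
rewrite -heytingP -[leRHS]os -heytingP meetAC.
exact: le_trans (leI2 (heyting_meet_le _ _) (lexx x)) (heyting_meet_le _ _).
Qed.

Lemma open_sublocale_mono a b :
  a <= b -> open_sublocale a `<=` open_sublocale b.
Proof.
move=> ab x ox; apply/open_sublocaleP.
rewrite -[leRHS]ox -heytingP.
exact: le_trans (leI2 (lexx _) ab) (heyting_meet_le _ _).
Qed.

Lemma open_sublocale_sub_interior a S :
  open_sublocale a `<=` S -> open_sublocale a `<=` sl_interior S.
Proof. by move=> aS; apply: open_sublocale_mono; apply: bigsup_ub. Qed.

Lemma heyting_bigsup A x :
  heyting (bigsup A) x = bigmeet [set heyting a x | a in A].
Proof.
apply/le_anti/andP; split.
  apply: bigmeet_ge_lb => _ [a Aa <-]; rewrite -heytingP.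
  exact: le_trans (leI2 (lexx _) (bigsup_ub _ _ Aa)) (heyting_meet_le _ _).
rewrite -heytingP meetC bigsup_meet_distr.
apply: bigsup_le_ub => _ [a Aa <-]; rewrite meetC heytingP.
by apply: bigmeet_lb; exists a.
Qed.

Lemma sl_interior_sub S : meet_closed S -> sl_interior S `<=` S.
Proof.
move=> Scl x <-; rewrite heyting_bigsup.
by apply: Scl => _ [a aS <-]; apply: aS; apply: open_sublocale_heyting.
Qed.

End OpenSublocales.

Lemma meet_closed_image (dL dM : Order.disp_t) (L : completeLatticeType dL)
    (M : completeLatticeType dM) (f : L -> M) (S : set L) :
  preserves_meets f -> meet_closed S -> meet_closed (f @` S).
Proof.
(* Taking every element of [S] that [f] sends into [A] avoids choosing preimages, and the image is
   still all of [A]. *)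
move=> hf Scl A AS; exists (bigmeet (S `&` f @^-1` A)).
  by apply: Scl => x [].
rewrite hf; congr bigmeet; apply/seteqP; split=> [_ [x [_ Ax] <-] //|y Ay].
have [x Sx fx] := AS _ Ay; exists x => //.
by split; rewrite // /preimage /= fx.
Qed.

Theorem proposition5p1 (dL dM : Order.disp_t) (L : localeType dL)
    (M : localeType dM) (f : L -> M) (hf : preserves_meets f) :
  open_map f <->
  (forall T : set M, meet_closed T ->
     sl_interior (sl_preimage f T) `<=` sl_preimage f (sl_interior T)).
Proof.
have preP (T : set M) : meet_closed T ->
    is_largest_sublocale_in (f @^-1` T) (sl_preimage f T).
  by move=> Tcl; apply: largest_sublocaleP; apply: meet_closed_preimage.
(* Hence [sl_preimage f (sl_interior T)] is a genuine largest sublocale, not the default value. *)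
have intcl (T : set M) : meet_closed (sl_interior T).
  exact: (open_sublocale_sublocale _).1.
split=> [fopen T Tcl|fint a].
  have [[Pcl _] PT _] := preP _ Tcl.
  have [_ _ maxI] := preP _ (intcl T).
  have intP := sl_interior_sub _ Pcl.
  (* By maximality, [f] only has to map the interior of [sl_preimage f T] into [sl_interior T]. Its
     image is open and lies in [T], which suffices. *)
  apply: maxI; first exact: open_sublocale_sublocale.
  have [b fb] := fopen (bigsup [set a | open_sublocale a `<=` sl_preimage f T]).
  have bT : open_sublocale b `<=` T.
    by rewrite -fb => _ [x /intP /PT Tx <-].
  move=> x ox; apply: (open_sublocale_sub_interior _ _ bT).
  by rewrite -fb; exists x.
have oa := open_sublocale_sublocale a.
pose T := f @` open_sublocale a.
have Tcl : meet_closed T by apply: meet_closed_image oa.1.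
exists (bigsup [set b | open_sublocale b `<=` T]).
apply/seteqP; split; last exact: sl_interior_sub.
have [_ _ maxT] := preP _ Tcl.
have [_ intT _] := preP _ (intcl T).
(* Being open, [open_sublocale a] then also lies in the interior of [sl_preimage f T], to which
   [fint] applies. *)
have aP : open_sublocale a `<=` sl_preimage f T.
  by apply: maxT => // x ox; exists x.
move=> _ [x ox <-]; apply/intT/(fint _ Tcl).
exact: open_sublocale_sub_interior aP _ ox.
Qed.
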